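(* Let $\alpha>0$, $n\ge2$ and $\beta=\sqrt{\alpha+1}$. Write $\overline k=\lceil k/2\rceil$ and $\underline k=\lfloor k/2\rfloor$. Let $M=(M_{p,q})_{1\le p,q\le n+1}$ be the $(n+1)\times(n+1)$ matrix with the following entries: Row 1: $\left(\alpha,\ r,\ r(r-s),\ 0,\ldots,0\right)$. Row 2: $\left(\alpha,\ s+\alpha(s-r),\ s(s-r),\ s(s-r)^2,\ 0,\ldots,0\right)$ (rows 1 and 2 truncated to length $n+1$ if necessary). Row 3: $M_{3,k+1}=\tfrac12\widetilde\mu_{\overline k+1,\underline k+1}+\widetilde\mu_{\overline k+1,\underline k}-\beta\,\widetilde\mu_{\overline k,\underline k}$ for $0\le k\le n$. Row 4 (if $n\ge3$): $M_{4,k+1}=\widetilde\mu_{\overline k+2,\underline k+1}+\widetilde\mu_{\overline k+2,\underline k}$ for $0\le k\le n$. Rows 5 through $n+1$ (if $n\ge4$): $M_{l+1,k+1}=\widetilde\mu_{\overline k+\overline l,\,\underline k+\underline l}$ for $4\le l\le n$, $0\le k\le n$. For $0\le k\le n$ let $M_k$ be the matrix obtained from $M$ by replacing its $(k+1)$st column by the column vector $b=(0,\ldots,0,K_n)^{T}$ with $n+1$ entries, where $K_n=\|\widehat L_{2,n}^{I,\alpha}\|^2$. Then the Type I $X_2$ exceptional Laguerre polynomials can be obtained through two representations: (A) $$\widehat L_{2,n}^{I,\alpha}(x)=(\det M)^{-1}\sum_{k=0}^n\det(M_k)\,(x-r)^{\overline k}(x-s)^{\underline k},$$ or, alternatively,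 (B) $\widehat L_{2,n}^{I,\alpha}(x)$ equals the determinant of the $(n+1)\times(n+1)$ matrix whose first $n$ rows are the first $n$ rows of $M$ and whose last row is $$\left(1,\ x-r,\ (x-r)(x-s),\ (x-r)^2(x-s),\ (x-r)^2(x-s)^2,\ \ldots,\ (x-r)^{\overline n}(x-s)^{\underline n}\right).$$
   Context: $L_n^{\gamma}(x)=\sum_{i=0}^n \binom{n+\gamma}{n-i}\frac{(-x)^i}{i!}$ denotes the classical Laguerre polynomial (with $L_{-1}^\gamma=0$). The Type I $X_2$ exceptional Laguerre polynomials, of degrees $n\ge2$, are $$\widehat L_{2,n}^{I,\alpha}(x)=L_2^{\alpha}(-x)L_{n-2}^{\alpha-1}(x)+L_2^{\alpha-1}(-x)L_{n-3}^{\alpha}(x).$$ They are orthogonal on $(0,\infty)$ with respect to the weight $$\widehat W(x)=\frac{x^{\alpha}e^{-x}}{\left(L_2^{\alpha-1}(-x)\right)^2},$$ and $\|\cdot\|$ is the norm of $L^2((0,\infty);\widehat W)$. The value of $K_n=\|\widehat L_{2,n}^{I,\alpha}\|^2$ depends on the normalization convention for the polynomials; it merely matters that $K_n$ is non-zero. The numbers $r=-(\alpha+1)-\sqrt{\alpha+1}$ and $s=-(\alpha+1)+\sqrt{\alpha+1}$ are the two roots of $L_2^{\alpha-1}(-x)=\tfrac12(x-r)(x-s)$. The adjusted moments are $$\widetilde\mu_{i,j}=\int_0^\infty (x-r)^i(x-s)^j\,\widehat W(x)\,dx\qquad(i,j\in\mathbb N_0).$$ The matrix $M$ is invertible.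
   Formalization: With the explicit formula for the polynomials, (A) fails for n=3 and (B) for n=2, α=1; here any nonzero multiple is allowed, (A) is an equality when the leading coefficient is 1 (1/2 if n=2), and otherwise (A) and (B) hold up to a nonzero constant factor. *)

(* Defs.v *)
From HB Require Import structures.
From mathcomp Require Import all_boot all_order all_algebra.
From mathcomp Require Import all_classical all_reals all_analysis.

Set Implicit Arguments.
Unset Strict Implicit.
Unset Printing Implicit Defensive.

Import Order.TTheory GRing.Theory Num.Theory.
Import numFieldNormedType.Exports.

Local Open Scope classical_set_scope.
Local Open Scope ring_scope.

(* Binomial coefficient with a real upper entry: x (x-1) ... (x-k+1) / k! *)
Definition gbinom (R : realType) (x : R) (k : nat) : R :=
  (\prod_(j < k) (x - j%:R)) / (k`!)%:R.

(* The degree is an integer because degree -1 occurs (for n = 2 in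
   [exc_laguerre]), with value 0. *)
Definition laguerre (R : realType) (m : int) (g : R) : {poly R} :=
  match m with
  | Posz n => \poly_(i < n.+1)
      (gbinom (n%:R + g) (n - i) * ((-1) ^+ i / (i`!)%:R))
  | Negz _ => 0
  end.

(* Type I X_2 exceptional Laguerre polynomial of degree n >= 2, in the
   standard normalization; [p \Po - 'X] is p(-x). *)
Definition exc_laguerre (R : realType) (alpha : R) (n : nat) : {poly R} :=
  (laguerre 2 alpha \Po - 'X) * laguerre (n%:Z - 2) (alpha - 1)
  + (laguerre 2 (alpha - 1) \Po - 'X) * laguerre (n%:Z - 3) alpha.

Definition weight (R : realType) (alpha x : R) : R :=
  x `^ alpha * expR (- x) / (laguerre 2 (alpha - 1)).[- x] ^+ 2.

(* Squared norm in L^2((0, oo); weight alpha) *)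
Definition normsq (R : realType) (alpha : R) (p : {poly R}) : R :=
  \int[lebesgue_measure]_(x in `]0, +oo[) (p.[x] ^+ 2 * weight alpha x).

Definition beta (R : realType) (alpha : R) : R := Num.sqrt (alpha + 1).
Definition root_r (R : realType) (alpha : R) : R := - (alpha + 1) - beta alpha.
Definition root_s (R : realType) (alpha : R) : R := - (alpha + 1) + beta alpha.

Definition adj_moment (R : realType) (alpha : R) (i j : nat) : R :=
  \int[lebesgue_measure]_(x in `]0, +oo[)
    ((x - root_r alpha) ^+ i * (x - root_s alpha) ^+ j * weight alpha x).

(* (x - r)^(ceil(k/2)) (x - s)^(floor(k/2)) *)
Definition adj_basis (R : realType) (alpha x : R) (k : nat) : R :=
  (x - root_r alpha) ^+ uphalf k * (x - root_s alpha) ^+ k./2.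

(* Entry in row i and column k, both counted from 0. *)
Definition mom_entry (R : realType) (alpha : R) (i k : nat) : R :=
  let r := root_r alpha in
  let s := root_s alpha in
  let mu := adj_moment alpha in
  match i with
  | 0%N => [:: alpha; r; r * (r - s)]`_k
  | 1%N => [:: alpha; s + alpha * (s - r); s * (s - r); s * (s - r) ^+ 2]`_k
  | 2%N => mu (uphalf k).+1 (k./2).+1 / 2 + mu (uphalf k).+1 k./2
           - beta alpha * mu (uphalf k) k./2
  | 3%N => mu (uphalf k).+2 (k./2).+1 + mu (uphalf k).+2 k./2
  | l => mu (uphalf k + uphalf l)%N (k./2 + l./2)%N
  end.

Definition mom_mx (R : realType) (alpha : R) (n : nat) : 'M[R]_n.+1 :=
  \matrix_(i, k) mom_entry alpha i k.

(* Column k replaced by (0, ..., 0, K)^T *)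
Definition mom_mx_repl (R : realType) (alpha : R) (n : nat) (K : R)
    (k : 'I_n.+1) : 'M[R]_n.+1 :=
  \matrix_(i, j) if j == k then (if i == ord_max then K else 0)
                 else mom_mx alpha n i j.

(* Last row replaced by the values of the adjusted basis at x *)
Definition mom_mx_last (R : realType) (alpha : R) (n : nat) (x : R) :
    'M[R]_n.+1 :=
  \matrix_(i, k) if i == ord_max then adj_basis alpha x k
                 else mom_mx alpha n i k.

(* Leading coefficient of the degree-n polynomial against which the last row
   of [mom_mx] integrates: (x-r)(x-s)/2 + (x-r) - beta for n = 2,
   (x-r)^2 (x-s) + (x-r)^2 for n = 3, and the n-th basis element for n >= 4.
   The last row and the right-hand side (0, ..., 0, |P|^2) are compatible
   exactly when P has this leading coefficient. *)
Definition lead_norm (R : realType) (n : nat) : R :=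
  if n == 2%N then 2^-1 else 1.

(* Main.v *)
Require Import Defs.
From HB Require Import structures.
From mathcomp Require Import all_boot all_order all_algebra.
From mathcomp Require Import all_classical all_reals all_analysis.
From mathcomp Require Import measurable_realfun ring lra.

Set Implicit Arguments.
Unset Strict Implicit.
Unset Printing Implicit Defensive.

Import Order.TTheory GRing.Theory Num.Theory.
Import numFieldNormedType.Exports.

Local Open Scope ring_scope.

(** Write [eta] for L_2^(alpha-1)(-x) = (x-r)(x-s)/2 and y for
    L_(n-2)^(alpha-1).  Since L_2^alpha(-x) = eta + eta' and
    y' = - L_(n-3)^alpha, the exceptional polynomial is
    P = (eta + eta') y - eta y' ([exc_laguerreE]), the image of y under the
    first-order operator y |-> - eta^2 e^x (e^(-x) y / eta)'.  Everything
    follows from this Darboux form.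

    Orthogonality.  Integrating by parts on (0, oo), the integral of P g
    against the exceptional weight is that of y (alpha g + x g') / eta against
    x^(alpha-1) e^(-x) ([wint_exc_laguerre]).  If alpha g + x g' vanishes at r
    and s, the quotient by eta is a polynomial of degree deg g - 2; hence P is
    orthogonal to every such g with deg g < n, because y is a classical
    Laguerre polynomial ([laguerre_orthogonal]).  The two vanishing conditions
    are exactly the first two rows of the matrix M, and the polynomials that
    satisfy them ([exceptional]) include P itself.

    Linear system.  The other rows of M integrate the adjusted basis against
    polynomials v_2, ..., v_n ([test_poly]) which are exceptional and have
    deg v_l = l.  Any exceptional polynomial of degree at most 1 is zero, so
    v_2, ..., v_n span the exceptional polynomials of degree at most n.
    Consequently a polynomial in the kernel of M is exceptional and orthogonal
    to itself, hence zero: M is invertible ([det_mom_mx_neq0]).  Applied to P,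
    all rows but the last give 0 by orthogonality, and the last gives
    |P|^2 times the quotient of the leading coefficients of v_n and P
    ([row_fun_exc_laguerre]).

    Determinants.  The coordinates of P are thus a multiple of the last column
    of the adjugate of M.  That column holds the cofactors of the last row,
    which are also the cofactors met when expanding det M_k along its column k
    and the determinant of (B) along its last row ([horner_of_rows],
    [det_mom_mx_repl], [det_mom_mx_last]).  So (A) and (B) are multiples of P,
    with equality in (A) when P has the leading coefficient of v_n. *)

(** * Integrating a derivative over the half-line *)

Section HalfLine.
Local Open Scope classical_set_scope.
Local Open Scope ring_scope.
Variable R : realType.
Implicit Types (F f h : R -> R) (a g x : R).
Local Notation mu := (@lebesgue_measure R).
Local Notation Rpos := (`]0%R, +oo[%classic : set R).

(** Compact intervals exhausting (0, oo): the integrands below may be singular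
    at 0, so the fundamental theorem of calculus is applied on these. *)
Definition cutoff (n : nat) : set R := `[n.+1%:R^-1, n.+2%:R]%classic.

Lemma cutoff_pos n x : cutoff n x -> 0 < x.
Proof.
rewrite /cutoff /= in_itv /= => /andP[+ _]; apply: lt_le_trans.
by rewrite invr_gt0.
Qed.

Lemma cutoff_nondecreasing : nondecreasing_seq cutoff.
Proof.
move=> m n mn; apply/subsetPset => x; rewrite /cutoff /= !in_itv /= => /andP[h1 h2].
apply/andP; split.
  by apply: le_trans h1; rewrite lef_pV2 ?posrE ?ltr0n// ler_nat ltnS.
by apply: le_trans h2 _; rewrite ler_nat !ltnS.
Qed.

Lemma bigcup_cutoff : (\bigcup_n cutoff n = Rpos)%classic.
Proof.
apply/seteqP; split => x /=.
  by case=> n _ /cutoff_pos; rewrite /= in_itv /= andbT.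
rewrite /= in_itv /= andbT => x0.
(* Any integer above both x and 1/x works. *)
pose k := Num.bound (Num.max x x^-1).
exists k => //; rewrite /cutoff /= in_itv /=.
have hk : Num.max x x^-1 < k%:R.
  apply: archi_boundP; rewrite le_max ltW //.
move: hk; rewrite gt_max => /andP[hx hxV].
apply/andP; split.
  rewrite -[leRHS]invrK lef_pV2 ?posrE ?invr_gt0 ?ltr0n//.
  by apply/ltW/(lt_le_trans hxV); rewrite ler_nat.
by apply/ltW/(lt_le_trans hx); rewrite ler_nat -addn2 leq_addr.
Qed.

Lemma measurable_cutoff n : measurable (cutoff n).
Proof. by rewrite /cutoff; apply: measurable_itv. Qed.

Lemma continuous_measurable_Rpos f :
  {in Rpos, continuous f} -> measurable_fun Rpos f.
Proof.
move=> cf; apply: open_continuous_measurable_fun => //; exact: interval_open.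
Qed.

Lemma integral_cutoff F f n :
  (forall x, 0 < x -> is_derive x 1 F (f x)) -> {in Rpos, continuous f} ->
  (\int[mu]_(x in cutoff n) (f x)%:E = (F n.+2%:R - F n.+1%:R^-1)%:E)%E.
Proof.
move=> dF cf.
have lt0 x : cutoff n x -> 0 < x by exact: cutoff_pos.
have ab : (n.+1%:R^-1 : R) < n.+2%:R.
  apply: (@le_lt_trans _ _ 1); first by rewrite invf_le1 ?ltr0n// ler1n.
  by rewrite ltr1n.
rewrite EFinB; apply: continuous_FTC2 => //.
- apply: continuous_in_subspaceT => x; rewrite inE => /lt0 x0.
  by apply: cf; rewrite inE /= in_itv /= x0.
- have dc x : 0 < x -> {for x, continuous F}.
    move=> x0; apply/differentiable_continuous/derivable1_diffP.
    by have /(@ex_derive _ _ _ _ _ _ _) := dF x x0.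
  have a0 : 0 < (n.+1%:R^-1 : R) by rewrite invr_gt0 ltr0n.
  split.
  + move=> x; rewrite in_itv /= => /andP[h _].
    by apply: ex_derive; apply: dF; apply: lt_trans h.
  + by apply: cvg_at_right_filter; apply: dc.
  + by apply: cvg_at_left_filter; apply: dc; apply: lt_trans ab.
- move=> x; rewrite in_itv /= => /andP[h _].
  rewrite derive1E; apply: derive_val; apply: dF.
  by apply: lt_trans h; rewrite invr_gt0 ltr0n.
Qed.

(** A nonnegative derivative of a bounded function is integrable: its integral
    over each cut-off is a difference of two values of the function, and
    monotone convergence passes to the half-line. *)
Lemma integrable_derivative_ge0 F f (B : R) :
  (forall x, 0 < x -> is_derive x 1 F (f x)) -> {in Rpos, continuous f} ->
  (forall x, 0 < x -> 0 <= f x) -> (forall x, 0 < x -> `|F x| <= B) ->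
  mu.-integrable Rpos (EFin \o f).
Proof.
move=> dF cf f0 FB.
have mf : measurable_fun Rpos f by exact: continuous_measurable_Rpos.
apply/integrableP; split; first exact/measurable_EFinP.
have h : (\int[mu]_(x in cutoff i) `|(EFin \o f) x| @[i --> \oo] -->
          \int[mu]_(x in \bigcup_i cutoff i) `|(EFin \o f) x|)%E.
  apply: ge0_nondecreasing_set_cvg_integral.
  - exact: cutoff_nondecreasing.
  - exact: measurable_cutoff.
  - move=> i; apply: measurableT_comp => //.
    apply/measurable_EFinP; apply: measurable_funS mf => //.
    by move=> x /cutoff_pos x0; rewrite /= in_itv /= x0.
  - by move=> i x _; exact: abse_ge0.
rewrite -bigcup_cutoff; apply: (@le_lt_trans _ _ (B + B)%:E); last exact: ltry.
rewrite -(cvg_lim _ h)//; apply: lime_le; first by apply/cvg_ex; eexists; exact: h.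
apply: nearW => i.
have -> : (\int[mu]_(x in cutoff i) `|(EFin \o f) x| =
           \int[mu]_(x in cutoff i) (f x)%:E)%E.
  by apply: eq_integral => x; rewrite inE => /cutoff_pos x0 /=; rewrite ger0_norm// f0.
rewrite (integral_cutoff _ dF cf) lee_fin.
apply: le_trans (ler_norm _) _; apply: le_trans (ler_normB _ _) _.
by apply: lerD; apply: FB; rewrite ?invr_gt0 ltr0n.
Qed.

(** Integrability is what allows the limit of the integrals over the cut-offs
    to be identified with the integral over the half-line: the positive and
    negative parts converge separately to finite values. *)
Lemma Rintegral_derivative_eq0 F f :
  (forall x, 0 < x -> is_derive x 1 F (f x)) -> {in Rpos, continuous f} ->
  mu.-integrable Rpos (EFin \o f) ->
  (F x @[x --> 0^'+] --> 0)%classic -> (F x @[x --> +oo] --> 0)%classic ->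
  \int[mu]_(x in Rpos) f x = 0.
Proof.
move=> dF cf fi F0 Foo.
pose ff := EFin \o f.
have mf : measurable_fun Rpos f by exact: continuous_measurable_Rpos.
have mff : measurable_fun Rpos ff by exact/measurable_EFinP.
have sub i : (cutoff i `<=` Rpos)%classic.
  by move=> x /cutoff_pos x0; rewrite /= in_itv /= x0.
have cvgpm (u : R -> \bar R) : measurable_fun Rpos u -> (forall x, 0 <= u x)%E ->
    (\int[mu]_(x in cutoff i) u x @[i --> \oo] --> \int[mu]_(x in Rpos) u x)%E%classic.
  move=> mu0 u0; rewrite -bigcup_cutoff.
  apply: ge0_nondecreasing_set_cvg_integral => //.
  - exact: cutoff_nondecreasing.
  - exact: measurable_cutoff.
  - by move=> i; apply: measurable_funS mu0.
have mpos : measurable_fun Rpos ff^\+%E by exact: measurable_funepos.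
have mneg : measurable_fun Rpos ff^\-%E by exact: measurable_funeneg.
have finp : (\int[mu]_(x in Rpos) ff^\+ x)%E \is a fin_num.
  by apply: integrable_fin_num => //; exact: integrable_funepos.
have finn : (\int[mu]_(x in Rpos) ff^\- x)%E \is a fin_num.
  by apply: integrable_fin_num => //; exact: integrable_funeneg.
have key : (\int[mu]_(x in cutoff i) ff x @[i --> \oo] -->
            \int[mu]_(x in Rpos) ff x)%E%classic.
  rewrite [X in (_ --> X)%classic]integralE.
  under eq_fun do rewrite integralE.
  apply: cvgeB; last 2 first.
  - by apply: cvgpm => // x; exact: funepos_ge0.
  - by apply: cvgpm => // x; exact: funeneg_ge0.
  by apply: fin_num_adde_defl; rewrite fin_numN.
have h0 : (\int[mu]_(x in cutoff i) ff x @[i --> \oo] --> 0%:E)%E%classic.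
  under eq_fun do rewrite /ff /= (integral_cutoff _ dF cf).
  apply: cvg_EFin; first exact: nearW.
  rewrite -[X in (_ --> X)%classic](subr0 0); apply: cvgB.
  - have /cvg_pinftyP/(_ (fun n => n.+2%:R)) := Foo; apply.
    apply/cvgryPge => r; near=> n.
    apply: (@le_trans _ _ n%:R); last by rewrite ler_nat -addn2 leq_addr.
    by near: n; exact: nbhs_infty_ger.
  - have /cvg_at_rightP/(_ (@harmonic R)) := F0; apply.
    by split; [move=> n; exact: harmonic_gt0|exact: cvg_harmonic].
rewrite /Rintegral (_ : integral _ _ _ = 0%:E)//.
by rewrite -(cvg_lim _ key)// (cvg_lim _ h0).
Unshelve. all: end_near.
Qed.

End HalfLine.

(** * Integrals of x^a e^(-x) against functions of subexponential growth *)

Section Subexponential.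
Local Open Scope classical_set_scope.
Local Open Scope ring_scope.
Variable R : realType.
Implicit Types (f h k : R -> R) (a g x : R).
Local Notation mu := (@lebesgue_measure R).
Local Notation Rpos := (`]0%R, +oo[%classic : set R).

(** Continuity is part of the notion, so that closure of this class under sums
    and products also supplies the measurability of all later integrands. *)
Definition subexp h :=
  {in Rpos, continuous h} /\
  forall e, 0 < e -> exists C, forall x, 0 < x -> `|h x| <= C * expR (e * x).

Lemma RposP x : (x \in Rpos) = (0 < x).
Proof. by rewrite mem_setE in_itv /= andbT. Qed.

Lemma subexp_eq h k : (forall x, 0 < x -> h x = k x) -> subexp h -> subexp k.
Proof.
move=> hk [ch bh]; split=> [x|e e0].
  move=> xp; have x0 : 0 < x by rewrite -RposP.
  rewrite /continuous_at -(hk x x0).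
  have := ch x xp; apply: cvg_trans; apply: near_eq_cvg.
  by near do apply: hk; exact: lt_nbhsr.
have [C hC] := bh e e0; exists C => x x0; rewrite -hk//; exact: hC.
Unshelve. all: end_near. Qed.

Lemma subexp_bounded h (B : R) : {in Rpos, continuous h} ->
  (forall x, 0 < x -> `|h x| <= B) -> subexp h.
Proof.
move=> ch hB; split=> // e e0; exists B => x x0.
have B0 : 0 <= B by apply: le_trans (hB x x0).
apply: le_trans (hB x x0) _; rewrite ler_peMr// -expR0 ler_expR.
by rewrite mulr_ge0// ltW.
Qed.

Lemma subexp_cst c : subexp (fun=> c).
Proof. by apply: (@subexp_bounded _ `|c|) => // x _; exact: cvg_cst. Qed.

Lemma subexpD h k : subexp h -> subexp k -> subexp (fun x => h x + k x).
Proof.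
move=> [ch bh] [ck bk]; split=> [x xp|e e0].
  by apply: cvgD; [exact: ch|exact: ck].
have [C hC] := bh e e0; have [D hD] := bk e e0.
exists (C + D) => x x0; rewrite mulrDl; apply: le_trans (ler_normD _ _) _.
by apply: lerD; [exact: hC|exact: hD].
Qed.

Lemma subexpM h k : subexp h -> subexp k -> subexp (fun x => h x * k x).
Proof.
move=> [ch bh] [ck bk]; split=> [x xp|e e0].
  by apply: cvgM; [exact: ch|exact: ck].
have e20 : 0 < e / 2 by rewrite divr_gt0.
have [C hC] := bh _ e20; have [D hD] := bk _ e20.
exists (C * D) => x x0; rewrite normrM [e in expR (e * x)]splitr mulrDl expRD mulrACA.
by apply: ler_pM => //; [exact: hC|exact: hD].
Qed.

Lemma subexp_id : subexp id.
Proof.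
split=> [x _|e e0]; first exact: cvg_id.
exists e^-1 => x x0; rewrite ger0_norm ?(ltW x0)//.
rewrite ler_pdivlMl//.
by apply: le_trans (expR_ge1Dx _); rewrite lerDr.
Qed.

Lemma subexp_horner (p : {poly R}) : subexp (horner p).
Proof.
elim/poly_ind: p => [|p c ih].
  by apply: subexp_eq (subexp_cst 0) => x _; rewrite horner0.
apply: (@subexp_eq (fun x => p.[x] * x + c)).
  by move=> x _; rewrite hornerMXaddC.
by apply: subexpD (subexp_cst c); apply: subexpM subexp_id.
Qed.

Lemma powR_continuous_gt0 a x : 0 < x -> {for x, continuous (fun y => y `^ a)}.
Proof.
move=> x0; apply/differentiable_continuous/derivable1_diffP.
exact: (@ex_derive _ _ _ _ _ _ _ (is_derive1_powR a x0)).
Qed.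

(** From 1 + u <= e^u with u = e x / a, raised to the power a. *)
Lemma subexp_powR a : 0 <= a -> subexp (fun x => x `^ a).
Proof.
rewrite le_eqVlt => /predU1P[<-|a0].
  by apply: subexp_eq (subexp_cst 1) => x _; rewrite powRr0.
split=> [x|e e0]; first by rewrite RposP; exact: powR_continuous_gt0.
exists ((a / e) `^ a) => x x0; rewrite ger0_norm ?powR_ge0//.
have -> : expR (e * x) = expR (e * x / a) `^ a.
  by rewrite -expRM mulfVK// gt_eqF.
rewrite -powRM ?expR_ge0 ?divr_ge0 ?(ltW a0) ?(ltW e0)//.
apply: ge0_ler_powR; rewrite ?nnegrE ?(ltW a0) ?(ltW x0)//.
  by rewrite mulr_ge0 ?expR_ge0 ?divr_ge0 ?ltW.
rewrite -ler_pdivrMl ?divr_gt0// invf_div.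
by apply: le_trans (expR_ge1Dx _); rewrite mulrAC lerDr.
Qed.

Lemma subexp_expRN : subexp (fun x => expR (- x)).
Proof.
apply: (@subexp_bounded _ 1) => [x _|x x0].
  by apply: continuous_comp; [exact: opp_continuous|exact: continuous_expR].
by rewrite ger0_norm ?expR_ge0// expR_le1 oppr_le0 ltW.
Qed.

Lemma gamma_continuous g h : subexp h ->
  {in Rpos, continuous (fun x => x `^ g * expR (- x) * h x)}.
Proof.
move=> [ch _] x xp; apply: cvgM; last exact: ch.
apply: cvgM; last by have [ce _] := subexp_expRN; exact: ce.
by apply: powR_continuous_gt0; rewrite -RposP.
Qed.

(** The antiderivative -1 / (1 + x^(a+1)) is bounded on (0, oo), while its
    derivative behaves like x^a near 0 and decays only polynomially at infinity:
    one function dominates x^a e^(-x) h at both ends. *)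
Lemma is_derive_Ninv_powR a x : 0 < x ->
  is_derive x 1 (fun y => - (1 + y `^ (a + 1))^-1)
    ((a + 1) * x `^ a / (1 + x `^ (a + 1)) ^+ 2).
Proof.
move=> x0.
have dp := is_derive1_powR (a + 1) x0.
have nz : 1 + x `^ (a + 1) != 0 by rewrite gt_eqF// ltr_wpDr ?powR_ge0.
have d1 : is_derive x 1 (fun y => 1 + y `^ (a + 1)) ((a + 1) * x `^ a).
  have := is_deriveD (is_derive_cst (1 : R) x (1 : R)) dp.
  by rewrite add0r addrK.
have d2 := is_deriveN (@is_deriveV R (fun y => 1 + y `^ (a + 1)) x _ _ nz d1).
apply: (is_derive_eq d2).
by rewrite /GRing.scale /= mulNr opprK mulrC.
Qed.

Lemma gamma_dominator_integrable a : -1 < a ->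
  mu.-integrable Rpos
    (EFin \o (fun x => (a + 1) * x `^ a / (1 + x `^ (a + 1)) ^+ 2)).
Proof.
move=> a1.
have nz x : 0 < 1 + x `^ (a + 1) by rewrite ltr_wpDr ?powR_ge0.
apply: (@integrable_derivative_ge0 _ (fun y => - (1 + y `^ (a + 1))^-1) _ 1).
- by move=> x; exact: is_derive_Ninv_powR.
- move=> x; rewrite RposP => x0.
  apply: cvgM; first by apply: cvgM; [exact: cvg_cst|exact: powR_continuous_gt0].
  apply: cvgV; first by rewrite expf_neq0// gt_eqF.
  apply: (@continuous_comp _ _ _ (fun y => 1 + y `^ (a + 1)) (fun z => z ^+ 2)).
    by apply: cvgD; [exact: cvg_cst|exact: powR_continuous_gt0].
  exact: exprn_continuous.
- move=> x x0; rewrite !mulr_ge0 ?invr_ge0 ?sqr_ge0 ?powR_ge0//.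
  by rewrite -[leRHS]opprK; move: a1; lra.
- move=> x x0; rewrite normrN ger0_norm ?invr_ge0 ?(ltW (nz x))//.
  by rewrite invf_le1// lerDl powR_ge0.
Qed.

Lemma gamma_integrable a h : -1 < a -> subexp h ->
  mu.-integrable Rpos (EFin \o (fun x => x `^ a * expR (- x) * h x)).
Proof.
move=> a1 sh; have a10 : 0 < a + 1 by move: a1; lra.
(* The factor h w e^(-x) left over after taking out the dominating function
   is bounded, because h w is subexponential. *)
pose w x := (1 + x `^ (a + 1)) ^+ 2.
have w0 x : 0 < w x by rewrite exprn_gt0// ltr_wpDr ?powR_ge0.
have sw : subexp (fun x => h x * w x).
  have s1 : subexp (fun x => 1 + x `^ (a + 1)).
    by apply: subexpD (subexp_cst 1) (subexp_powR _); exact: ltW.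
  by apply: subexpM => //; exact: subexpM.
have [C hC] := sw.2 1 ltr01.
pose dom x := (a + 1) * x `^ a / w x.
have idom := @integrableZl _ _ _ mu _ (measurable_itv _) (C / (a + 1)) _
  (gamma_dominator_integrable a1).
apply: (@le_integrable _ _ _ mu _ (measurable_itv _) _ _ _ _ idom).
- apply/measurable_EFinP; apply: continuous_measurable_Rpos.
  exact: gamma_continuous.
- move=> x /=; rewrite in_itv /= andbT => x0.
  rewrite lee_fin; apply: le_trans (ler_norm _).
  rewrite !normrM (ger0_norm (powR_ge0 _ _)) (ger0_norm (expR_ge0 _)).
  have -> : C / (a + 1) * dom x = x `^ a * (C / w x).
    by rewrite /dom; field; rewrite !gt_eqF.
  rewrite -mulrA ler_wpM2l ?powR_ge0// ler_pdivlMr// -mulrA expRN mulrC.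
  rewrite ler_pdivrMr ?expR_gt0//.
  by have := hC x x0; rewrite mul1r normrM (gtr0_norm (w0 x)).
Qed.

(** The integrand is the derivative of x^a e^(-x) h, which tends to 0 at 0
    because a > 0 and at infinity because h grows subexponentially. *)
Lemma Rintegral_gamma_derivative a h h' : 0 < a -> subexp h -> subexp h' ->
  (forall x, 0 < x -> is_derive x 1 h (h' x)) ->
  \int[mu]_(x in Rpos)
    (x `^ (a - 1) * expR (- x) * (a * h x + x * h' x - x * h x)) = 0.
Proof.
move=> a0 sh sh' dh.
have sub : subexp (fun x => a * h x + x * h' x - x * h x).
  apply: (@subexp_eq (fun x => a * h x + x * h' x + (-1) * (x * h x))).
    by move=> x _; rewrite mulN1r.
  have sx := subexp_id.
  by apply: subexpD; [apply: subexpD; apply: subexpM => //; exact: subexp_cst|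
    apply: subexpM; [exact: subexp_cst|exact: subexpM]].
apply: (@Rintegral_derivative_eq0 _ (fun x => x `^ a * expR (- x) * h x)).
- move=> x x0.
  have dp := is_derive1_powR a x0.
  have de : is_derive x 1 (fun y => expR (- y)) (- expR (- x)).
    have dN : is_derive x (1 : R) -%R (-1 : R) by exact: is_deriveNid.
    by have := is_derive1_comp (is_derive_expR (- x)) dN; rewrite mulrN1.
  have := is_deriveM (is_deriveM dp de) (dh x x0).
  move=> /is_derive_eq; apply.
  change (x `^ a * expR (- x) * h' x + h x * (x `^ a * - expR (- x) +
     expR (- x) * (a * x `^ (a - 1))) =
     x `^ (a - 1) * expR (- x) * (a * h x + x * h' x - x * h x)).
  rewrite -(mulr_powRB1 (ltW x0) a0); ring.
- exact: gamma_continuous.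
- by apply: gamma_integrable => //; move: a0; lra.
- have [C hC] := sh.2 1 ltr01.
  apply: norm_cvg0; apply: (@squeeze_cvgr _ _ _ _ (fun=> 0) (fun x => C * x `^ a)).
  + near=> x; rewrite normr_ge0 /=.
    have x0 : 0 < x by near: x; exact: nbhs_right_gt.
    rewrite 2!normrM (ger0_norm (powR_ge0 _ _)) (ger0_norm (expR_ge0 _)).
    rewrite -mulrA mulrC ler_wpM2r ?powR_ge0// expRN mulrC.
    by rewrite ler_pdivrMr ?expR_gt0//; have := hC x x0; rewrite mul1r.
  + exact: cvg_cst.
  + rewrite -[X in _ --> X](mulr0 C); by apply: cvgM; [exact: cvg_cst|exact: powR_cvg0].
(* Half of the exponential bounds x^a h, the other half tends to 0. *)
- have e20 : 0 < (1 / 2 : R) by rewrite divr_gt0.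
  have [C hC] := (subexpM (subexp_powR (ltW a0)) sh).2 _ e20.
  apply: norm_cvg0; apply: (@squeeze_cvgr _ _ _ _ (fun=> 0)
    (fun x => C * expR (- (1 / 2 * x)))).
  + near=> x; rewrite normr_ge0 /=.
    have x0 : 0 < x by near: x; exact: nbhs_pinfty_gt.
    rewrite mulrAC normrM (ger0_norm (expR_ge0 _)).
    have -> : - (1 / 2 * x) = 1 / 2 * x - x by field.
    by rewrite expRD mulrA ler_wpM2r ?expR_ge0// hC.
  + exact: cvg_cst.
  + rewrite -[X in _ --> X](mulr0 C); apply: cvgM; first exact: cvg_cst.
    apply: (@cvg_comp _ _ _ (fun x => 1 / 2 * x) (fun y => expR (- y)) _ _ _ _ (@cvgr_expR R)).
    by apply: gt0_cvgMry => //; exact: cvg_id.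
Unshelve. all: end_near.
Qed.

End Subexponential.

(** * Classical Laguerre polynomials *)

Section Laguerre.
Variable R : realType.
Implicit Types (a g x : R) (m n : nat) (p q : {poly R}).

Lemma gbinomS x k : k.+1%:R * gbinom x k.+1 = (x - k%:R) * gbinom x k.
Proof.
rewrite /gbinom big_ord_recr /= factS natrM.
by field; rewrite !gt_eqF ?ltr0n ?fact_gt0.
Qed.

Lemma gbinom0 x : gbinom x 0 = 1.
Proof. by rewrite /gbinom big_ord0 fact0 divr1. Qed.

Lemma coef_laguerre m g i :
  (laguerre m%:Z g)`_i =
  if (i <= m)%N then gbinom (m%:R + g) (m - i) * ((-1) ^+ i / i`!%:R) else 0.
Proof. by rewrite /laguerre coef_poly ltnS. Qed.

Lemma deriv_laguerre m g :
  (laguerre m%:Z g)^`() = - laguerre (m%:Z - 1) (g + 1).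
Proof.
case: m => [|m]; apply/polyP => i; rewrite coef_deriv coefN coef_laguerre.
  by rewrite /= coef0 oppr0 mul0rn.
rewrite -predn_int // coef_laguerre ltnS; case: leqP => im; last by rewrite mul0rn oppr0.
rewrite subSS (_ : m.+1%:R + g = m%:R + (g + 1)); last by rewrite -natr1; ring.
rewrite -mulr_natr factS natrM exprS.
by field; rewrite !gt_eqF ?ltr0n ?fact_gt0.
Qed.

(** One step of the Rodrigues formula, stated without the weight: multiplied by
    x^g e^(-x), the right-hand side is the derivative of
    x^(g+1) e^(-x) L_m^(g+1). *)
Lemma laguerre_rodrigues m g :
  m.+1%:R *: laguerre m.+1%:Z g =
  (g + 1) *: laguerre m%:Z (g + 1) + 'X * (laguerre m%:Z (g + 1))^`()
  - 'X * laguerre m%:Z (g + 1).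
Proof.
apply/polyP => i.
rewrite coefB coefD !coefZ !coefXM coef_deriv !coef_laguerre.
have -> : m.+1%:R + g = m%:R + (g + 1) by rewrite -natr1; ring.
set x := m%:R + (g + 1).
case: i => [|i] /=.
  rewrite subn0 fact0 expr0 subn0 addr0 subr0 mulrA gbinomS /x; ring.
rewrite ltnS subSS.
have [im|mi] := ltnP i m; last first.
  rewrite mul0rn mulr0 addr0 add0r.
  have [im|im] := leqP i m; last by rewrite mulr0 oppr0.
  have -> : i = m by apply/eqP; rewrite eqn_leq im.
  rewrite subnn gbinom0 factS natrM exprS.
  by field; rewrite !gt_eqF ?ltr0n ?fact_gt0.
rewrite (ltnW im).
have := gbinomS x (m - i.+1); rewrite subnSK//.
have -> : x - (m - i.+1)%:R = g + 2 + i%:R.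
  by rewrite /x natrB// -natr1; ring.
rewrite natrB 1?ltnW// => e.
rewrite -mulr_natr factS natrM exprS -natr1.
have fi : (i`!%:R : R) != 0 by rewrite gt_eqF ?ltr0n ?fact_gt0.
have i1 : (1 + i%:R : R) != 0 by rewrite nat1r gt_eqF ?ltr0n.
rewrite -!nat1r.
apply/eqP; rewrite -subr_eq0; apply/eqP.
transitivity ((-1) ^+ i / i`!%:R / (1 + i%:R) * 
  ((g + 2 + i%:R) * gbinom x (m - i.+1) - (m%:R - i%:R) * gbinom x (m - i)) * (-1) * (-1)).
  by field; rewrite fi nat1r -nat1r i1.
by rewrite -e subrr mulr0 !mul0r.
Qed.

Lemma size_laguerre m (b : R) : size (laguerre m%:Z b) = m.+1.
Proof.
apply/eqP; rewrite eqn_leq size_poly /=.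
rewrite ltnNge; apply/negP => /leq_sizeP/(_ m (leqnn m))/eqP.
rewrite coef_laguerre leqnn subnn gbinom0 mul1r mulf_eq0 signr_eq0 invr_eq0.
by rewrite pnatr_eq0 (gtn_eqF (fact_gt0 m)).
Qed.

End Laguerre.

Section Orthogonality.
Variable R : realType.
Implicit Types (a g x : R) (m n : nat) (p q : {poly R}).
Local Notation mu := (@lebesgue_measure R).
Local Notation Rpos := (`]0%R, +oo[%classic : set R).

(** Integrating by parts with [laguerre_rodrigues] replaces (m+1, g, q) by
    (m, g+1, q') up to a constant factor.  The degree of q stays below the index
    of the Laguerre polynomial, so q has become 0 when the index is 0. *)
Lemma laguerre_orthogonal m g q : -1 < g -> (size q <= m)%N ->
  \int[mu]_(x in Rpos)
    (x `^ g * expR (- x) * (laguerre m%:Z g * q).[x]) = 0.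
Proof.
elim: m g q => [|m IH] g q g1 sq.
  move: sq; rewrite leqn0 size_poly_eq0 => /eqP ->.
  under eq_Rintegral do rewrite mulr0 horner0 mulr0.
  by rewrite Rintegral_cst ?mul0r//; exact: measurable_itv.
have g10 : 0 < g + 1 by move: g1; lra.
pose L := laguerre m%:Z (g + 1).
have := @Rintegral_gamma_derivative R (g + 1) (horner (L * q))
  (horner (L * q)^`()) g10 (subexp_horner _) (subexp_horner _)
  (fun x _ => is_derive_poly _ x).
have int b p : -1 < b ->
    mu.-integrable Rpos (EFin \o (fun x => x `^ b * expR (- x) * p.[x])).
  by move=> b1; apply: gamma_integrable b1 (subexp_horner p).
have split_int x : x \in Rpos ->
    x `^ (g + 1 - 1) * expR (- x) *
      ((g + 1) * (L * q).[x] + x * (L * q)^`().[x] - x * (L * q).[x]) =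
    m.+1%:R * (x `^ g * expR (- x) * (laguerre m.+1%:Z g * q).[x]) +
    x `^ (g + 1) * expR (- x) * (L * q^`()).[x].
  rewrite RposP => x0; rewrite addrK -(mulr_powRB1 (ltW x0) g10) addrK.
  have /(congr1 (horner^~ x)) := laguerre_rodrigues m g; rewrite -/L.
  rewrite derivM !(hornerD, hornerN, hornerM, hornerZ, hornerX) => e.
  rewrite [RHS](_ : _ = x `^ g * expR (- x) *
     ((m.+1%:R * (laguerre m.+1%:Z g).[x]) * q.[x] + x * (L.[x] * q^`().[x]))); last by ring.
  rewrite e; ring.
under eq_Rintegral => x xp do rewrite (split_int x xp).
rewrite RintegralD.
- rewrite (IH (g + 1) q^`()); last 2 first.
  + by move: g1; lra.
  + have [->|q0] := eqVneq q 0; first by rewrite deriv0 size_poly0.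
    by rewrite -ltnS; apply: leq_trans (lt_size_deriv q0) sq.
  rewrite addr0 RintegralZl; [|exact: measurable_itv|exact: int].
  by move=> /eqP; rewrite mulf_eq0 pnatr_eq0 /= => /eqP.
- exact: measurable_itv.
- exact: (@integrableZl _ _ _ mu _ (measurable_itv _) m.+1%:R _ (int _ _ g1)).
- by apply: int; move: g1; lra.
Qed.

End Orthogonality.

(** * The denominator of the weight and the Darboux form *)

Section Denominator.
Variable R : realType.
Implicit Types (a x : R) (m n : nat) (p q : {poly R}).

(** This is the polynomial called eta, also in the notation once alpha is
    fixed. *)
Definition wden a : {poly R} := laguerre 2 (a - 1) \Po - 'X.

Lemma gbinom1 (x : R) : gbinom x 1 = x.
Proof. by rewrite /gbinom big_ord1 (_ : 1`! = 1%N)// divr1 subr0. Qed.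

Lemma gbinom2 (x : R) : gbinom x 2 = x * (x - 1) / 2.
Proof. by rewrite /gbinom big_ord_recr big_ord1 (_ : 2`! = 2%N)//= subr0. Qed.

Lemma laguerre2_opp (g : R) : laguerre 2 g \Po - 'X =
  2^-1 *: 'X^2 + (g + 2) *: 'X + ((g + 1) * (g + 2) / 2)%:P.
Proof.
have c2 : laguerre 2 g =
  (gbinom (2 + g) 2)%:P - (2 + g) *: 'X + 2^-1 *: 'X^2.
  apply/polyP => -[|[|[|i]]]; rewrite coef_laguerre /=;
    rewrite !coefD coefN !coefZ coefC coefX coefXn /= ?fact0 ?gbinom1 ?gbinom0.
  - by rewrite expr0 divr1; ring.
  - by rewrite expr1 divr1; ring.
  - by rewrite sqrrN expr1n (_ : 2`! = 2%N)//; field.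
  - by ring.
rewrite c2 !comp_polyD -scaleNr !comp_polyZ comp_polyC comp_polyX expr2 comp_polyM.
rewrite comp_polyX gbinom2 mulrNN -expr2 scalerN scaleNr opprK.
rewrite (_ : (2 + g) * (2 + g - 1) / 2 = (g + 1) * (g + 2) / 2); last by field.
by rewrite [RHS]addrC [2^-1 *: 'X^2 + _]addrC addrA [2 + g]addrC.
Qed.

Lemma beta_sqr a : 0 < a -> beta a ^+ 2 = a + 1.
Proof. by move=> a0; rewrite /beta sqr_sqrtr//; move: a0; lra. Qed.

Lemma wdenE a : 0 < a ->
  wden a = 2^-1 *: (('X - (root_r a)%:P) * ('X - (root_s a)%:P)).
Proof.
move=> a0.
have -> : ('X - (root_r a)%:P) * ('X - (root_s a)%:P) =
  'X^2 - (root_r a + root_s a) *: 'X + (root_r a * root_s a)%:P.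
  move: (root_r a) (root_s a) => r s.
  by rewrite -mul_polyC polyCD polyCM; ring.
rewrite /wden laguerre2_opp scalerDr scalerBr scalerA -scaleNr -mulrN.
have -> : root_r a * root_s a = (a - 1 + 1) * (a - 1 + 2).
  rewrite /root_r /root_s; move: (beta a) (beta_sqr a0) => b b2.
  by transitivity ((a + 1) ^+ 2 - b ^+ 2); [ring|rewrite b2; ring].
rewrite -[2^-1 *: _%:P]mul_polyC -polyCM; congr (_ + _%:P); last by rewrite mulrC.
by congr (_ + _ *: _); rewrite /root_r /root_s; field.
Qed.

Lemma horner_wden a x : 0 < a ->
  (wden a).[x] = (x - root_r a) * (x - root_s a) / 2.
Proof.
by move=> a0; rewrite wdenE// !(hornerZ, hornerM, hornerD, hornerN, hornerX, hornerC) mulrC.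
Qed.

Lemma beta_gt1 a : 0 < a -> 1 < beta a.
Proof. by move=> a0; rewrite /beta -[ltLHS]sqrtr1 ltr_sqrt; move: a0; lra. Qed.

Lemma root_s_lt0 a : 0 < a -> root_s a < 0.
Proof.
by move=> a0; have := beta_gt1 a0; rewrite /root_s -beta_sqr//; nra.
Qed.

Lemma root_rs a : 0 < a -> root_r a < root_s a.
Proof. by move=> a0; have := beta_gt1 a0; rewrite /root_s /root_r; lra. Qed.

Lemma wden_gt0 a x : 0 < a -> 0 <= x -> 0 < (wden a).[x].
Proof.
move=> a0 x0; rewrite horner_wden//.
have := root_s_lt0 a0; have := root_rs a0 => h1 h2.
by rewrite divr_gt0// mulr_gt0//; move: h1 h2 x0; lra.
Qed.

Lemma deriv_wden a : (wden a)^`() = 'X + (a + 1)%:P.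
Proof.
rewrite /wden laguerre2_opp !derivD !derivZ derivXn derivX derivC addr0 /= expr1.
rewrite -(scaler_nat 2 'X) scalerA mulVf ?pnatr_eq0// scale1r alg_polyC.
by congr (_ + _%:P); ring.
Qed.

Lemma laguerre2_wden a : laguerre 2 a \Po - 'X = wden a + (wden a)^`().
Proof.
rewrite deriv_wden /wden !laguerre2_opp -!mul_polyC.
apply/polyP => i; rewrite !(coefD, coefCM, coefC, coefX, coefXn).
by case: i => [|[|[|i]]] /=; field.
Qed.

(** The Darboux form of the exceptional polynomials, with y the classical
    polynomial from which they are obtained. *)
Lemma exc_laguerreE a m : let y := laguerre m%:Z (a - 1) in
  exc_laguerre a m.+2 = (wden a + (wden a)^`()) * y - wden a * y^`().
Proof.
rewrite /= /exc_laguerre -laguerre2_wden deriv_laguerre subrK mulrN opprK.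
rewrite (_ : m.+2%:Z - 2 = m%:Z); last by rewrite -addn2 PoszD addrK.
by rewrite (_ : m.+2%:Z - 3 = m%:Z - 1)//; rewrite -addn2 PoszD; ring.
Qed.

End Denominator.

(** * Integration against the exceptional weight *)

Section Exceptional.
Variable R : realType.
Variable alpha : R.
Hypothesis alpha_gt0 : 0 < alpha.
Implicit Types (c x z : R) (i k l m n : nat) (g p q : {poly R}).
Local Notation mu := (@lebesgue_measure R).
Local Notation Rpos := (`]0%R, +oo[%classic : set R).
Local Notation r := (root_r alpha).
Local Notation s := (root_s alpha).
Local Notation eta := (wden alpha).

Definition wint p : R := \int[mu]_(x in Rpos) (p.[x] * weight alpha x).

Lemma weightE x :
  weight alpha x = x `^ alpha * expR (- x) / eta.[x] ^+ 2.
Proof. by rewrite /weight /wden horner_comp !hornerE. Qed.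

Lemma subexp_wden_inv : subexp (fun x => eta.[x]^-1).
Proof.
apply: (@subexp_bounded _ _ eta.[0]^-1) => [x|x x0].
  rewrite RposP => x0; apply: cvgV; last exact: continuous_horner.
  by rewrite gt_eqF// wden_gt0// ltW.
have e0 := wden_gt0 alpha_gt0 (ltW x0).
rewrite ger0_norm ?invr_ge0 ?(ltW e0)// lef_pV2 ?posrE ?e0 ?wden_gt0//.
rewrite !horner_wden// ler_pM2r ?invr_gt0//.
have := root_s_lt0 alpha_gt0; have := root_rs alpha_gt0 => h1 h2.
by apply: ler_pM; move: h1 h2 x0; lra.
Qed.

Lemma subexp_horner_weight p :
  subexp (fun x => p.[x] / eta.[x] ^+ 2).
Proof.
apply: (@subexp_eq _ (fun x => p.[x] * (eta.[x]^-1 * eta.[x]^-1))).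
  by move=> x _; rewrite -expr2 exprVn.
apply: subexpM; first exact: subexp_horner.
by apply: subexpM; exact: subexp_wden_inv.
Qed.

Lemma horner_weightE p x : p.[x] * weight alpha x =
  x `^ alpha * expR (- x) * (p.[x] / eta.[x] ^+ 2).
Proof. by rewrite weightE mulrCA mulrA. Qed.

Lemma wint_integrable p :
  mu.-integrable Rpos (EFin \o (fun x => p.[x] * weight alpha x)).
Proof.
have -> : (fun x => p.[x] * weight alpha x) =
  (fun x => x `^ alpha * expR (- x) * (p.[x] / eta.[x] ^+ 2)).
  by apply/funext => x; exact: horner_weightE.
apply: gamma_integrable; last exact: subexp_horner_weight.
by move: alpha_gt0; lra.
Qed.

Lemma wintD p q : wint (p + q) = wint p + wint q.
Proof.
rewrite -RintegralD; [|exact: measurable_itv|exact: wint_integrable..].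
by apply: eq_Rintegral => x _; rewrite hornerD mulrDl.
Qed.

Lemma wintZ c p : wint (c *: p) = c * wint p.
Proof.
rewrite -RintegralZl; [|exact: measurable_itv|exact: wint_integrable].
by rewrite [LHS]/wint; apply: eq_Rintegral => x _; rewrite hornerZ -mulrA.
Qed.

Lemma weight_gt0 x : 0 < x -> 0 < weight alpha x.
Proof.
move=> x0; rewrite weightE; apply: divr_gt0.
  by rewrite mulr_gt0 ?powR_gt0 ?expR_gt0.
by rewrite exprn_gt0// wden_gt0// ltW.
Qed.

(** The polynomial vanishes almost everywhere on (0, oo), hence at some point of
    each interval (i, i+1), which gives more roots than its degree allows. *)
Lemma wint_sqr_eq0 p : wint (p ^+ 2) = 0 -> p = 0.
Proof.
move=> w0; apply/eqP/negPn/negP => p0.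
have ip := wint_integrable (p ^+ 2).
have := fineK (@integrable_fin_num _ _ _ mu _ (measurable_itv _) _ ip).
rewrite [fine _](_ : _ = wint (p ^+ 2)) // w0 => i0.
have : (\int[mu]_(x in Rpos)
    `|(EFin \o (fun x => (p ^+ 2).[x] * weight alpha x)%R) x| = 0)%E.
  rewrite [RHS]i0; apply: eq_integral => x; rewrite RposP => x0.
  rewrite gee0_abs// lee_fin horner_exp mulr_ge0 ?sqr_ge0//.
  by rewrite ltW// weight_gt0.
move/(ae_eq_integral_abs mu (measurable_itv _) (measurable_int mu ip)).
move=> [N [mN N0 subN]].
have rootp (i : nat) : exists x, i%:R < x < i.+1%:R /\ root p x.
  apply: contrapT => nx.
  have : (mu `](i%:R : R), i.+1%:R[%classic <= mu N)%E.
    apply: (@le_measure _ _ _ mu); [by apply: mem_set; apply: measurable_itv|by apply: mem_set|].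
    move=> x /= xi; apply: subN => /= eqx; apply: nx; exists x.
    move: xi; rewrite in_itv /= => xi; split=> //.
    have x0 : 0 < x by case/andP: xi => ix _; exact: le_lt_trans (ler0n R i) ix.
    have /eqx/eqP : Rpos x by rewrite /= in_itv /= andbT.
    rewrite /= horner_exp eqe mulf_eq0 (gt_eqF (weight_gt0 x0)) orbF.
    by rewrite expf_eq0.
  rewrite N0 lebesgue_measure_itv /= lte_fin ltr_nat leqnn.
  by rewrite -EFinB -natr1 addrAC subrr add0r lee_fin ler10.
(* Distinct intervals yield distinct roots, so that the first [size p] of them
   contradict the bound on the number of roots. *)
have [u hu] := choice rootp.
have uinj : injective u.
  move=> i j uij; apply/eqP; rewrite eqn_leq.
  have [/andP[i1 i2] _] := hu i; have [/andP[j1 j2] _] := hu j.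
  rewrite -ltnS -(ltr_nat R) (lt_trans i1) ?uij//=.
  by rewrite -ltnS -(ltr_nat R) (lt_trans j1) -?uij.
have := @max_poly_roots _ p (map u (iota 0 (size p))) p0.
rewrite size_map size_iota ltnn map_inj_uniq// iota_uniq => H.
apply: (notF (H _ isT)); apply/allP => _ /mapP[i _ ->].
by have [] := hu i.
Qed.

(** The operator alpha + x d/dx: x^(alpha-1) times its value is the derivative
    of x^alpha p. *)
Definition euler p : {poly R} := alpha *: p + 'X * p^`().

(** Integration by parts transfers the Darboux operator from the exceptional
    polynomial to g: x^alpha e^(-x) g y / eta has derivative
    x^(alpha-1) e^(-x) y q minus the integrand on the left. *)
Lemma wint_exc_laguerre m g q :
  euler g = eta * q ->
  wint (exc_laguerre alpha m.+2 * g) =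
  \int[mu]_(x in Rpos) (x `^ (alpha - 1) * expR (- x) *
     (laguerre m%:Z (alpha - 1) * q).[x]).
Proof.
move=> gq; set y := laguerre m%:Z (alpha - 1).
pose h x := (g * y).[x] / eta.[x].
pose h' x := ((g * y)^`() * eta - g * y * eta^`()).[x] /
             eta.[x] ^+ 2.
have w0 x : 0 < x -> eta.[x] != 0.
  by move=> x0; rewrite gt_eqF// wden_gt0// ltW.
have sh : subexp h by apply: subexpM; [exact: subexp_horner|exact: subexp_wden_inv].
have sh' : subexp h' by exact: subexp_horner_weight.
have dh x : 0 < x -> is_derive x 1 h (h' x).
  move=> x0.
  have := is_deriveM (is_derive_poly (g * y) x)
    (is_deriveV (w0 x x0) (is_derive_poly eta x)).
  move=> /is_derive_eq; apply; rewrite /h' /GRing.scale /=.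
  rewrite !(hornerD, hornerN, hornerM).
  by field; exact: w0.
have := Rintegral_gamma_derivative alpha_gt0 sh sh' dh.
have split_int x : x \in Rpos ->
    x `^ (alpha - 1) * expR (- x) * (alpha * h x + x * h' x - x * h x) =
    x `^ (alpha - 1) * expR (- x) * (y * q).[x] -
    (exc_laguerre alpha m.+2 * g).[x] * weight alpha x.
  rewrite RposP => x0; rewrite weightE -(mulr_powRB1 (ltW x0) alpha_gt0).
  have /(congr1 (horner^~ x)) := gq; rewrite /euler.
  rewrite exc_laguerreE -/y /h /h' derivM.
  rewrite !(hornerD, hornerN, hornerM, hornerZ, hornerX) => e.
  have -> : q.[x] = (alpha * g.[x] + x * g^`().[x]) / eta.[x].
    by rewrite e mulrC mulKf// w0.
  by field; exact: w0.
under eq_Rintegral => x xp do rewrite (split_int x xp).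
have a1 : -1 < alpha - 1 by move: alpha_gt0; lra.
have i1 := gamma_integrable a1 (subexp_horner (y * q)).
rewrite (@RintegralB _ _ _ mu _ _ _ (measurable_itv _) i1 (wint_integrable _)).
by move/subr0_eq.
Qed.

Lemma exc_laguerre_orthogonal m g q : (size q <= m)%N ->
  euler g = eta * q ->
  wint (exc_laguerre alpha m.+2 * g) = 0.
Proof.
move=> sq /wint_exc_laguerre ->; apply: laguerre_orthogonal sq.
by move: alpha_gt0; lra.
Qed.

(** The range of the Darboux operator is cut out by these two conditions; they
    say that eta divides [euler p] ([exceptional_factor]). *)
Definition exceptional p := (euler p).[r] = 0 /\ (euler p).[s] = 0.

Lemma eulerD p q : euler (p + q) = euler p + euler q.
Proof. by rewrite /euler scalerDr derivD mulrDr addrACA. Qed.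

Lemma eulerZ c p : euler (c *: p) = c *: euler p.
Proof. by rewrite /euler derivZ scalerDr !scalerA mulrC -scalerAr. Qed.

Lemma exceptionalD p q : exceptional p -> exceptional q -> exceptional (p + q).
Proof.
case=> p1 p2 [q1 q2].
by rewrite /exceptional eulerD (hornerD _ _ r) (hornerD _ _ s) p1 p2 q1 q2 addr0. Qed.

Lemma exceptionalZ c p : exceptional p -> exceptional (c *: p).
Proof. by case=> p1 p2; rewrite /exceptional eulerZ (hornerZ _ _ r) (hornerZ _ _ s) p1 p2 mulr0. Qed.

Lemma size_euler p : (size (euler p) <= size p)%N.
Proof.
apply/leq_sizeP => j pj; rewrite coefD coefZ coefXM coef_deriv.
case: j pj => [|j] pj /=; first by rewrite nth_default// mulr0 addr0.
by rewrite !nth_default// mulr0 mul0rn addr0.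
Qed.

Lemma exceptional_factor p : exceptional p ->
  exists2 q, euler p = eta * q & (size q <= (size p).-2)%N.
Proof.
move=> [p1 p2].
have : ('X - r%:P) * ('X - s%:P) %| euler p.
  have := @uniq_roots_dvdp _ (euler p) [:: r; s].
  rewrite uniq_rootsE !big_cons big_nil mulr1 /= !rootE p1 p2 !eqxx /=; apply => //.
  by rewrite inE (lt_eqF (root_rs alpha_gt0)).
move=> /dvdpP[q e].
have eq : euler p = eta * (2 *: q).
  by rewrite wdenE// e -scalerAl -scalerAr scalerA mulVf ?pnatr_eq0// scale1r mulrC.
exists (2 *: q) => //; rewrite size_scale ?pnatr_eq0//.
have [->|q0] := eqVneq q 0; first by rewrite size_poly0.
have := size_euler p; rewrite e mulrA !size_mul ?polyXsubC_eq0 ?mulf_neq0 ?polyXsubC_eq0//.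
have e2 j : (j + 2%R).-1 = j.+1 by rewrite (_ : j + 2%R = j + 2)%N// addn2.
by rewrite !size_XsubC !e2; case: (size p) => [|[|k]].
Qed.

Lemma exc_laguerre_orthogonal_exceptional n p : (1 < n)%N ->
  exceptional p -> (size p <= n)%N -> wint (exc_laguerre alpha n * p) = 0.
Proof.
case: n => [|[|m]]// _ /exceptional_factor[q e sq] sp.
apply: exc_laguerre_orthogonal e => //; apply: leq_trans sq _.
by rewrite -subn2 leq_subLR add2n.
Qed.

(** At a root z of eta one has P = eta' y and P' = (eta' + eta'') y, so that
    alpha P + z P' = 2 eta y = 0. *)
Lemma exceptional_exc_laguerre n : (1 < n)%N -> exceptional (exc_laguerre alpha n).
Proof.
case: n => [|[|m]]// _.
have wr : eta.[r] = 0 by rewrite horner_wden// subrr !mul0r.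
have ws : eta.[s] = 0 by rewrite horner_wden// subrr mulr0 mul0r.
suff key z : eta.[z] = 0 -> (euler (exc_laguerre alpha m.+2)).[z] = 0.
  by split; exact: key.
move=> wz; rewrite exc_laguerreE /euler; set y := laguerre _ _.
rewrite !(derivM, derivD, derivN, deriv_wden, derivX, derivC, addr0).
rewrite !(hornerD, hornerN, hornerM, hornerZ, hornerX, hornerC) wz.
move: wz; rewrite /wden laguerre2_opp.
rewrite !(hornerD, hornerN, hornerM, hornerZ, hornerX, hornerC, hornerXn) => wz.
transitivity (2 * y.[z] * (2^-1 * z ^+ 2 + (alpha - 1 + 2) * z +
      (alpha - 1 + 1) * (alpha - 1 + 2) / 2)); last by rewrite wz mulr0.
by field.
Qed.

Lemma size_wden : size eta = 3.
Proof.
rewrite wdenE// size_scale ?invr_eq0 ?pnatr_eq0//.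
by rewrite size_mul ?polyXsubC_eq0// !size_XsubC.
Qed.

Lemma size_exc_laguerre n : (1 < n)%N -> size (exc_laguerre alpha n) = n.+1.
Proof.
case: n => [|[|m]]// _; rewrite exc_laguerreE; set y := laguerre _ _.
have sy : size y = m.+1 by exact: size_laguerre.
have y0 : y != 0 by rewrite -size_poly_gt0 sy.
have w0 : eta != 0 by rewrite -size_poly_gt0 size_wden.
rewrite mulrDl -addrA size_polyDl size_mul// size_wden sy// !addSn.
apply: leq_ltn_trans (size_polyD _ _) _.
rewrite gtn_max size_polyN; apply/andP; split.
  by apply: leq_ltn_trans (size_polyMleq _ _) _; rewrite deriv_wden size_XaddC sy.
apply: leq_ltn_trans (size_polyMleq _ _) _; rewrite size_wden !addSn /= ltnS.
by have := lt_size_deriv y0; rewrite sy !ltnS.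
Qed.

(** * The adjusted basis and the rows of the matrix *)

Definition adj_poly k : {poly R} :=
  ('X - r%:P) ^+ uphalf k * ('X - s%:P) ^+ k./2.

Lemma horner_adj_poly k x : (adj_poly k).[x] = adj_basis alpha x k.
Proof. by rewrite /adj_poly /adj_basis hornerM !horner_exp !hornerXsubC. Qed.

Lemma adj_poly_monic k : adj_poly k \is monic.
Proof. by rewrite monicMl ?monic_exp ?monicXsubC. Qed.

Lemma size_adj_poly k : size (adj_poly k) = k.+1.
Proof.
rewrite size_monicM ?monic_exp ?monicXsubC ?monic_neq0 ?monic_exp ?monicXsubC//.
by rewrite !size_exp_XsubC addnS /= addSn uphalf_half -addnA addnn odd_double_half.
Qed.

Lemma coef_adj_poly k : (adj_poly k)`_k = 1.
Proof. by have /monicP := adj_poly_monic k; rewrite lead_coefE size_adj_poly. Qed.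

Lemma adj_poly0 : adj_poly 0 = 1.
Proof. by rewrite /adj_poly !expr0 mulr1. Qed.

Lemma adj_poly1 : adj_poly 1 = 'X - r%:P.
Proof. by rewrite /adj_poly expr0 mulr1. Qed.

Lemma adj_polySS k : adj_poly k.+2 = ('X - r%:P) * ('X - s%:P) * adj_poly k.
Proof. by rewrite /adj_poly /= !exprS mulrACA. Qed.

(** The exceptional polynomials integrated against in rows 3, 4, ... of the
    matrix.  From degree 4 on the basis elements have double zeros at r and s
    and qualify as they are; in degrees 2 and 3 they do not, and exceptional
    polynomials of these degrees take their place. *)
Definition test_poly l : {poly R} :=
  match l with
  | 2 => exc_laguerre alpha 2
  | 3 => ('X - r%:P) ^+ 2 * ('X - s%:P + 1)
  | _ => adj_poly l
  end.

Lemma euler_double_root z p : (euler (('X - z%:P) ^+ 2 * p)).[z] = 0.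
Proof.
rewrite /euler expr2 !derivM derivXsubC.
by rewrite !(hornerXsubC, hornerD, hornerM, hornerZ, hornerX) subrr; ring.
Qed.

Lemma exc_laguerre2 : exc_laguerre alpha 2 =
  2^-1 *: (('X - r%:P) * ('X - s%:P)) + ('X - r%:P) - (beta alpha)%:P.
Proof.
rewrite exc_laguerreE (_ : laguerre 0 _ = 1); last first.
  apply/polyP => i; rewrite coef_laguerre coef1.
  by case: i => [|i] //=; rewrite gbinom0 expr0 fact0 divr1 mulr1.
rewrite derivC mulr0 subr0 mulr1 -wdenE// deriv_wden -!addrA; congr (_ + (_ + _)).
by rewrite /root_r -!polyCN -polyCD; congr _%:P; ring.
Qed.

Lemma exceptional_test_poly l : (1 < l)%N -> exceptional (test_poly l).
Proof.
case: l => [|[|[|[|l]]]]// _; first exact: exceptional_exc_laguerre.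
  split; first exact: euler_double_root.
  rewrite /test_poly /euler !(derivM, derivD, derivN, derivX, derivC, expr2).
  rewrite !(hornerD, hornerN, hornerM, hornerZ, hornerX, hornerC) !subrr !subr0.
  rewrite /root_r /root_s.
  have := beta_sqr alpha_gt0; move: (beta alpha) => b b2.
  have -> : alpha = b ^+ 2 - 1 by rewrite b2 addrK.
  by ring.
rewrite /test_poly !adj_polySS; split.
  by rewrite [X in euler X](_ : _ = ('X - r%:P) ^+ 2 * (('X - s%:P) ^+ 2 * adj_poly l));
    [exact: euler_double_root|ring].
by rewrite [X in euler X](_ : _ = ('X - s%:P) ^+ 2 * (('X - r%:P) ^+ 2 * adj_poly l));
  [exact: euler_double_root|ring].
Qed.

Lemma lead_test_poly l : (1 < l)%N ->
  (size (test_poly l) <= l.+1)%N /\ (test_poly l)`_l = lead_norm R l.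
Proof.
have sX z : (size ('X - z%:P)%R <= 2)%N by rewrite size_XsubC.
case: l => [|[|[|[|l]]]]// _.
- split; first by rewrite size_exc_laguerre.
  have := coef_adj_poly 2; rewrite adj_polySS adj_poly0 mulr1 => b2.
  rewrite /test_poly exc_laguerre2 coefB coefD coefZ b2 coefC subr0.
  by rewrite [('X - _)`_2]nth_default// addr0 mulr1.
- have -> : test_poly 3 = adj_poly 3 + ('X - r%:P) ^+ 2.
    by rewrite adj_polySS adj_poly1 /test_poly; ring.
  have s3 : size (('X - r%:P) ^+ 2) = 3 by rewrite size_exp_XsubC.
  split; last by rewrite coefD coef_adj_poly nth_default ?s3// addr0.
  by apply: leq_trans (size_polyD _ _) _; rewrite geq_max size_adj_poly s3.
- by split; [rewrite /test_poly size_adj_poly|rewrite /test_poly coef_adj_poly].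
Qed.

(** The linear form whose values on the adjusted basis make up row i. *)
Definition row_fun i p : R :=
  match i with
  | 0%N => (euler p).[r]
  | 1%N => (euler p).[s]
  | l => wint (test_poly l * p)
  end.

Lemma row_funD i p q : row_fun i (p + q) = row_fun i p + row_fun i q.
Proof.
case: i => [|[|i]] /=; rewrite ?eulerD; [exact: hornerD..|].
by rewrite mulrDr wintD.
Qed.

Lemma row_funZ i c p : row_fun i (c *: p) = c * row_fun i p.
Proof.
case: i => [|[|i]] /=; rewrite ?eulerZ; [exact: hornerZ..|].
by rewrite -scalerAr wintZ.
Qed.

Lemma adj_momentE i j :
  adj_moment alpha i j = wint (('X - r%:P) ^+ i * ('X - s%:P) ^+ j).
Proof.
apply: eq_Rintegral => x _.
by rewrite hornerM !horner_exp !hornerXsubC.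
Qed.

Lemma euler_adj_poly_r k : (euler (adj_poly k)).[r] = [:: alpha; r; r * (r - s)]`_k.
Proof.
case: k => [|[|[|k]]]; rewrite ?adj_polySS ?adj_poly0 ?adj_poly1 /=; last first.
  case: k => [|k]; rewrite ?adj_polySS ?adj_poly1 nth_nil.
    by rewrite mulrAC -expr2 euler_double_root.
  rewrite (_ : _ * _ = ('X - r%:P) ^+ 2 * (('X - s%:P) ^+ 2 * adj_poly k)).
    by rewrite euler_double_root.
  by ring.
- rewrite /euler mulr1 !(derivM, derivXsubC).
  by rewrite !(hornerXsubC, hornerD, hornerM, hornerZ, hornerX, hornerC) subrr; ring.
- rewrite /euler derivXsubC.
  by rewrite !(hornerXsubC, hornerD, hornerM, hornerZ, hornerX, hornerC) subrr; ring.
- by rewrite /euler derivC mulr0 addr0 hornerZ hornerC mulr1.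
Qed.

Lemma euler_adj_poly_s k : (euler (adj_poly k)).[s] =
  [:: alpha; s + alpha * (s - r); s * (s - r); s * (s - r) ^+ 2]`_k.
Proof.
case: k => [|[|[|[|k]]]]; rewrite ?adj_polySS ?adj_poly0 ?adj_poly1 /=; last first.
- rewrite (_ : _ * _ = ('X - s%:P) ^+ 2 * (('X - r%:P) ^+ 2 * adj_poly k)).
    by rewrite euler_double_root nth_nil.
  by rewrite /=; ring.
- rewrite /euler !(derivM, derivXsubC).
  by rewrite !(hornerXsubC, hornerD, hornerM, hornerZ, hornerX, hornerC) subrr; ring.
- rewrite /euler mulr1 !(derivM, derivXsubC).
  by rewrite !(hornerXsubC, hornerD, hornerM, hornerZ, hornerX, hornerC) subrr; ring.
- rewrite /euler derivXsubC.
  by rewrite !(hornerXsubC, hornerD, hornerM, hornerZ, hornerX, hornerC); ring.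
- by rewrite /euler derivC mulr0 addr0 hornerZ hornerC mulr1.
Qed.

Lemma mom_entryE i k : mom_entry alpha i k = row_fun i (adj_poly k).
Proof.
case: i => [|[|[|[|i]]]].
- by rewrite /= euler_adj_poly_r.
- by rewrite /= euler_adj_poly_s.
- rewrite /mom_entry /row_fun /test_poly exc_laguerre2 !adj_momentE.
  rewrite [X in _ = wint X](_ : _ =
      2^-1 *: (('X - r%:P) ^+ (uphalf k).+1 * ('X - s%:P) ^+ (k./2).+1) +
      ('X - r%:P) ^+ (uphalf k).+1 * ('X - s%:P) ^+ k./2 +
      (- beta alpha) *: (('X - r%:P) ^+ uphalf k * ('X - s%:P) ^+ k./2)).
    by rewrite !wintD// !wintZ// mulNr mulrC.
  by rewrite -!mul_polyC polyCN /adj_poly !exprS; ring.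
- rewrite /mom_entry /row_fun /test_poly !adj_momentE -wintD//.
  by congr (wint _); rewrite /adj_poly !exprS; ring.
- change (adj_moment alpha (uphalf k + uphalf i.+4) (k./2 + i.+4./2) =
          wint (adj_poly i.+4 * adj_poly k)).
  rewrite adj_momentE.
  by congr (wint _); rewrite /adj_poly !exprD mulrACA mulrC.
Qed.

(** * Invertibility of the matrix *)

Definition comb n (c : 'rV[R]_n) : {poly R} := \sum_(k < n) c 0 k *: adj_poly k.

Definition adj_poly_mx n : 'M[R]_n := \matrix_(i, j) (adj_poly i)`_j.

(** Unitriangular, because the k-th basis element is monic of degree k. *)
Lemma adj_poly_mx_unit n : adj_poly_mx n \in unitmx.
Proof.
rewrite unitmxE det_trig.
  by rewrite big1 ?unitr1// => i _; rewrite mxE coef_adj_poly.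
by apply/is_trig_mxP => i j ij; rewrite mxE nth_default// size_adj_poly.
Qed.

Lemma comb_rVpoly n (c : 'rV[R]_n) : comb c = rVpoly (c *m adj_poly_mx n).
Proof.
apply/polyP => j; rewrite coef_rVpoly; case: insubP => [i _ ij|].
  rewrite /comb coef_sum mxE; apply: eq_bigr => k _.
  by rewrite coefZ mxE ij.
rewrite -leqNgt => nj; rewrite /comb coef_sum big1// => k _.
by rewrite coefZ nth_default ?mulr0// size_adj_poly (leq_trans (ltn_ord k)).
Qed.

Lemma comb_exists n p : (size p <= n)%N -> exists c : 'rV[R]_n, p = comb c.
Proof.
move=> sp; exists (poly_rV p *m invmx (adj_poly_mx n)).
by rewrite comb_rVpoly mulmxKV ?adj_poly_mx_unit// poly_rV_K.
Qed.

Lemma comb_eq0 n (c : 'rV[R]_n) : comb c = 0 -> c = 0.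
Proof.
rewrite comb_rVpoly => /(congr1 (poly_rV : _ -> 'rV[R]_n)); rewrite rVpolyK linear0.
by move=> /(canRL (mulmxK (adj_poly_mx_unit n))); rewrite mul0mx.
Qed.

Lemma size_comb n (c : 'rV[R]_n) : (size (comb c) <= n)%N.
Proof. by rewrite comb_rVpoly size_poly. Qed.

Lemma row_fun_comb n (c : 'rV[R]_n.+1) (i : 'I_n.+1) :
  row_fun i (comb c) = \sum_(k < n.+1) mom_mx alpha n i k * c 0 k.
Proof.
rewrite /comb (big_morph (row_fun i) (row_funD i) (id1 := 0)); last first.
  by rewrite -[X in row_fun i X](scale0r 0) row_funZ// mul0r.
by apply: eq_bigr => k _; rewrite row_funZ// mxE mom_entryE// mulrC.
Qed.

(** On a + b x the two conditions read alpha a + (alpha + 1) b z = 0 at z = r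
    and z = s; as r <> s they force a = b = 0. *)
Lemma exceptional_low_eq0 p : exceptional p -> (size p <= 2)%N -> p = 0.
Proof.
move=> [p1 p2] sp.
have pE : p = (p`_0)%:P + p`_1 *: 'X.
  apply/polyP => -[|[|j]]; rewrite coefD coefC coefZ coefX /=;
    rewrite ?mulr0 ?mulr1 ?addr0 ?add0r//.
  by rewrite nth_default// (leq_trans sp).
have eE z : (euler p).[z] = alpha * p`_0 + (alpha + 1) * p`_1 * z.
  rewrite {1}pE /euler derivD derivC derivZ derivX.
  by rewrite !(hornerD, hornerM, hornerZ, hornerX, hornerC); ring.
move: p1 p2; rewrite !eE => p1 p2.
have : (alpha + 1) * p`_1 * (s - r) = 0.
  by rewrite mulrBr; apply/eqP; rewrite subr_eq0; apply/eqP/(addrI (alpha * p`_0)); rewrite p1 p2.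
move=> /eqP; rewrite mulf_eq0 subr_eq0 (gt_eqF (root_rs alpha_gt0)) orbF.
rewrite mulf_eq0 gt_eqF ?addr_gt0//= => /eqP c1.
move: p1; rewrite c1 mulr0 mul0r addr0 => /eqP.
by rewrite mulf_eq0 gt_eqF//= => /eqP c0; rewrite pE c0 c1 scale0r addr0.
Qed.

Lemma lead_norm_neq0 l : lead_norm R l != 0.
Proof. by rewrite /lead_norm; case: ifP => _; rewrite ?oner_neq0// invr_eq0 pnatr_eq0. Qed.

Lemma cancel_lead n p q (c : R) : (size p <= n.+1)%N -> (size q <= n.+1)%N ->
  p`_n = c * q`_n -> (size (p - c *: q)%R <= n)%N.
Proof.
move=> sp sq pq; apply/leq_sizeP => j; rewrite leq_eqVlt => /predU1P[<-|nj].
  by rewrite coefB coefZ pq subrr.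
by rewrite coefB coefZ !nth_default ?mulr0 ?subr0//; apply: leq_trans nj.
Qed.

(** The test polynomials span the exceptional polynomials of degree at most n:
    subtracting multiples of them lowers the degree until
    [exceptional_low_eq0] applies. *)
Lemma exceptional_span_orthogonal n p q : exceptional p -> (size p <= n.+1)%N ->
  (forall l, (1 < l <= n)%N -> wint (test_poly l * q) = 0) -> wint (p * q) = 0.
Proof.
have wint0 : wint 0 = 0 by rewrite -(scale0r 0) wintZ// mul0r.
case: n => [|n].
  by move=> ep sp _; rewrite (exceptional_low_eq0 ep) ?mul0r// (leq_trans sp).
elim: n p => [|n IH] p ep sp orth.
  by rewrite (exceptional_low_eq0 ep)// mul0r.
have [st lt] := lead_test_poly (isT : (1 < n.+2)%N).
(* This multiple of the test polynomial has the same leading term as p. *)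
pose c := p`_n.+2 / lead_norm R n.+2.
have -> : p = (p - c *: test_poly n.+2) + c *: test_poly n.+2 by rewrite subrK.
rewrite mulrDl wintD// -scalerAl wintZ// orth ?leqnn// mulr0 addr0.
apply: IH.
- rewrite -scaleNr; apply: exceptionalD => //; apply: exceptionalZ => //.
  exact: exceptional_test_poly.
- by apply: cancel_lead => //; rewrite lt /c divfK// lead_norm_neq0.
- by move=> l /andP[l1 l2]; apply: orth; rewrite l1 leqW.
Qed.

(** A vector in the kernel is the coordinate vector of an exceptional polynomial
    that is orthogonal to all test polynomials, hence to itself. *)
Lemma det_mom_mx_neq0 n : (1 < n)%N -> \det (mom_mx alpha n) != 0.
Proof.
move=> n1; rewrite -det_tr; apply/det0P => -[v v0 vM].
move/eqP: v0; apply; apply: comb_eq0; apply: wint_sqr_eq0.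
have row0 (i : 'I_n.+1) : row_fun i (comb v) = 0.
  rewrite row_fun_comb; move/matrixP/(_ 0 i): vM; rewrite !mxE => e; rewrite -[RHS]e.
  by apply: eq_bigr => k _; rewrite [_^T k i]mxE mulrC.
rewrite expr2; apply: (@exceptional_span_orthogonal n); last first.
- move=> l /andP[l1 ln]; have := row0 (Ordinal (ln : (l < n.+1)%N)).
  by case: l l1 ln => [|[|l]].
- exact: size_comb.
- split; first exact: (row0 (Ordinal (isT : (0 < n.+1)%N))).
  by have := row0 (Ordinal (leqW n1 : (1 < n.+1)%N)).
Qed.

(** * Determinantal representations *)

Lemma cofactor_mom_mx_last n x (k : 'I_n.+1) :
  cofactor (mom_mx_last alpha n x) ord_max k = cofactor (mom_mx alpha n) ord_max k.
Proof.
congr (_ * \det _); apply/matrixP => i j; rewrite !mxE.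
by rewrite eq_sym (negPf (neq_lift _ _)).
Qed.

Lemma cofactor_mom_mx_repl n (K : R) (k : 'I_n.+1) :
  cofactor (mom_mx_repl alpha K k) ord_max k = cofactor (mom_mx alpha n) ord_max k.
Proof.
congr (_ * \det _); apply/matrixP => i j; rewrite !mxE.
by rewrite eq_sym (negPf (neq_lift _ _)).
Qed.

Lemma det_mom_mx_last n x : \det (mom_mx_last alpha n x) =
  \sum_(k < n.+1) cofactor (mom_mx alpha n) ord_max k * adj_basis alpha x k.
Proof.
rewrite (expand_det_row _ ord_max); apply: eq_bigr => k _.
by rewrite cofactor_mom_mx_last mxE eqxx mulrC.
Qed.

Lemma det_mom_mx_repl n (K : R) (k : 'I_n.+1) : \det (mom_mx_repl alpha K k) =
  K * cofactor (mom_mx alpha n) ord_max k.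
Proof.
rewrite (expand_det_col _ k) (bigD1 ord_max)//= big1 ?addr0.
  by rewrite cofactor_mom_mx_repl mxE !eqxx.
by move=> i /negPf im; rewrite mxE eqxx im mul0r.
Qed.

(** Cramer's rule for a right-hand side supported on the last row: applying the
    adjugate leaves only the cofactors of that row, which are the coefficients
    of the determinant with last row replaced by the basis values. *)
Lemma horner_of_rows n p (t : R) x : (size p <= n.+1)%N ->
  (forall i : 'I_n.+1, row_fun i p = if i == ord_max then t else 0) ->
  \det (mom_mx alpha n) * p.[x] = t * \det (mom_mx_last alpha n x).
Proof.
move=> /comb_exists[c ->] rows.
have Mc : mom_mx alpha n *m c^T = \col_i (if i == ord_max then t else 0).
  apply/matrixP => i j; rewrite !mxE -rows row_fun_comb.
  by apply: eq_bigr => k _; rewrite [_^T k j]mxE (ord1 j).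
have := congr1 (mulmx (\adj (mom_mx alpha n))) Mc.
rewrite mulmxA mul_adj_mx mul_scalar_mx => /matrixP adjM.
rewrite det_mom_mx_last /comb horner_sum !mulr_sumr; apply: eq_bigr => k _.
rewrite hornerZ horner_adj_poly [LHS]mulrA [RHS]mulrA; congr (_ * _).
have := adjM k 0; rewrite !mxE => ->.
rewrite (bigD1 ord_max)//= big1 ?addr0 => [|i /negPf im].
  by rewrite !mxE eqxx mulrC.
by rewrite !mxE im mulr0.
Qed.

Lemma normsqE p : normsq alpha p = wint (p ^+ 2).
Proof. by apply: eq_Rintegral => x _; rewrite horner_exp. Qed.

(** In the last row, the test polynomial minus a multiple of P is exceptional of
    degree less than n, hence orthogonal to P; only the multiple of |P|^2
    remains. *)
Lemma row_fun_exc_laguerre n (c : R) (i : 'I_n.+1) : (1 < n)%N -> c != 0 ->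
  let P := c *: exc_laguerre alpha n in
  row_fun i P =
  if i == ord_max then lead_norm R n / lead_coef P * normsq alpha P else 0.
Proof.
move=> n1 c0 P.
have eP : exceptional P by apply: exceptionalZ => //; exact: exceptional_exc_laguerre.
have sP : size P = n.+1 by rewrite size_scale// size_exc_laguerre.
have lP : lead_coef P = P`_n by rewrite lead_coefE sP.
have lP0 : P`_n != 0 by rewrite -lP lead_coef_eq0 -size_poly_gt0 sP.
have orth p : exceptional p -> (size p <= n)%N -> wint (p * P) = 0.
  move=> ep sp; rewrite mulrC -scalerAl wintZ//.
  by rewrite exc_laguerre_orthogonal_exceptional// mulr0.
have rowE : (1 < i)%N -> row_fun i P = wint (test_poly i * P).
  by case: i => -[|[|i]].
have [i1|i1] := ltnP 1 i; last first.
  have [_ /negbTE ->] : True /\ i != ord_max.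
    by split=> //; apply: contraTneq i1 => ->; rewrite -ltnNge.
  case: eP => e1 e2; case: i i1 {rowE} => -[|[|i]] //= _ _.
have [si li] := lead_test_poly i1.
rewrite rowE//; case: eqVneq => [im|im]; last first.
  apply: orth; first exact: exceptional_test_poly.
  by apply: leq_trans si _; rewrite ltn_neqAle -ltnS ltn_ord andbT.
rewrite normsqE lP.
have iE : nat_of_ord i = n by rewrite im.
rewrite iE in si li *.
set t := lead_norm R n / P`_n.
have e0 : wint ((test_poly n - t *: P) * P) = 0.
  apply: orth.
    rewrite -scaleNr; apply: exceptionalD => //; last exact: exceptionalZ.
    exact: exceptional_test_poly.
  by apply: cancel_lead => //; rewrite ?sP// li /t divfK.
by move: e0; rewrite mulrBl -scaleN1r wintD// wintZ// -scalerAl wintZ// mulN1r => /subr0_eq ->.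
Qed.

End Exceptional.

(* The constant c is the choice of normalization of the polynomial P. *)
Theorem theorem4p1 (R : realType) (alpha : R) (n : nat) (c : R)
    (alpha_gt0 : 0 < alpha) (n_ge2 : (2 <= n)%N) (c_neq0 : c != 0) :
  let P := c *: exc_laguerre alpha n in
  let K := normsq alpha P in
  let M := mom_mx alpha n in
  let repA := fun x : R =>
    (\det M)^-1 *
    \sum_(k < n.+1) \det (mom_mx_repl alpha K k) * adj_basis alpha x k in
  let repB := fun x : R => \det (mom_mx_last alpha n x) in
  [/\ \det M != 0,
      lead_coef P = lead_norm R n -> forall x : R, P.[x] = repA x,
      exists2 a : R, a != 0 & forall x : R, P.[x] = a * repA x
    & exists2 b : R, b != 0 & forall x : R, P.[x] = b * repB x].
Proof.
move=> P K M repA repB.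
have M0 : \det M != 0 by exact: det_mom_mx_neq0.
have sP : size P = n.+1 by rewrite size_scale// size_exc_laguerre.
have P0 : P != 0 by rewrite -size_poly_gt0 sP.
have K0 : K != 0.
  by apply: contraNneq P0; rewrite /K normsqE => /(wint_sqr_eq0 alpha_gt0) ->.
pose lambda := lead_norm R n / lead_coef P.
have lambda0 : lambda != 0.
  by rewrite mulf_neq0 ?lead_norm_neq0// invr_eq0 lead_coef_eq0.
have repBE x : P.[x] = lambda * K / \det M * repB x.
  apply: (mulfI M0); rewrite (@horner_of_rows _ _ alpha_gt0 n P (lambda * K)) ?sP//.
    by rewrite -/(repB x); field.
  by move=> i; rewrite row_fun_exc_laguerre.
have repAE x : P.[x] = lambda * repA x.
  rewrite repBE /repA /repB det_mom_mx_last.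
  under [in RHS]eq_bigr do rewrite det_mom_mx_repl -mulrA.
  by rewrite -mulr_sumr -/M; field.
split=> //.
- by move=> lP x; rewrite repAE /lambda lP divff ?mul1r// lead_norm_neq0.
- by exists lambda.
- by exists (lambda * K / \det M) => //; rewrite mulf_neq0 ?invr_neq0// mulf_neq0.
Qed.
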